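(* (Level Correspondence) Let $0<r<n$ be integers, let $T=(\mathbb{C}^* )^n$ act on the Grassmannian $Gr(r,n)$ in the standard way and on the dual Grassmannian $Gr(n-r,n)$ by the dual action, and let $E_r$, $E_{n-r}$ be the standard representations of $\mathrm{GL}(r,\mathbb{C})$ and $\mathrm{GL}(n-r,\mathbb{C})$, respectively. For $l\in\mathbb{Z}$ consider the equivariant $K$-theoretic $I$-functions with level structure $$I_T^{Gr(r,n),E_r,l}=1+\sum_{d=1}^{\infty}I^{Gr(r,n),E_r,l}_{T,d}\,Q^d,\qquad I_T^{Gr(n-r,n),E_{n-r}^\vee,-l}=1+\sum_{d=1}^{\infty}I^{Gr(n-r,n),E^\vee_{n-r},-l}_{T,d}\,Q^d,$$ whose coefficients are given by the explicit formulas in the context. Then for every $d\ge 1$ the following relations hold in $K^{loc}_T(Gr(r,n))\otimes\mathbb{C}(q)\cong K^{loc}_T(Gr(n-r,n))\otimes\mathbb{C}(q)$: (1) For $1-r\le l\le n-r-1$, $$I_{T,d}^{Gr(r,n),E_{r},l}=I_{T,d}^{Gr(n-r,n),E_{n-r}^\vee,-l}.$$ (2) For $l=n-r$, $$I_{T,d}^{Gr(r,n),E_{r},l}=\sum_{s=0}^d C_{s}(n-r,d)\,I_{T,d-s}^{Gr(n-r,n),E_{n-r}^\vee,-l},\qquad C_{s}(k,d)=\frac{(-1)^{ks}}{(q;q)_{s}\,q^{s(d-s+k)}\left(\bigwedge^{top}\mathcal{S}_{n-r}\right)^s},$$ where $\mathcal{S}_{n-r}$ is the tautological bundle of $Gr(n-r,n)$.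 (3) For $l=-r$, $$I_{T,d}^{Gr(n-r,n),E_{n-r}^\vee,-l}=\sum_{s=0}^d D_{s}(r,d)\,I_{T,d-s}^{Gr(r,n),E_{r},l},\qquad D_{s}(r,d)=\frac{(-1)^{rs}}{(q;q)_s\,q^{s(d-s)}\left(\bigwedge^{top}\mathcal{S}_{r}\right)^s},$$ where $\mathcal{S}_r$ is the tautological bundle of $Gr(r,n)$.
   Context: Pochhammer symbol: $(a;q)_0=1$ and $(a;q)_d=(1-a)(1-qa)\cdots(1-q^{d-1}a)$ for $d>0$. Torus actions. $Gr(r,n)=M_{r\times n}(\mathbb{C})/\!/_{\det}\mathrm{GL}(r,\mathbb{C})$, with $\mathrm{GL}(r,\mathbb{C})$ acting by left multiplication; $T=(\mathbb{C}^* )^n$ acts on $\mathbb{C}^n$ with weights $\mathbb{C}^n=\Lambda_1+\cdots+\Lambda_n$, inducing $t\cdot A=At$ on $Gr(r,n)$. $Gr(n-r,n)=M_{(n-r)\times n}(\mathbb{C})/\!/_{\det}\mathrm{GL}(n-r,\mathbb{C})$ with the dual torus action, i.e. $\mathbb{C}^n=\Lambda_1^{-1}+\cdots+\Lambda_n^{-1}$ and $t\cdot B=Bt^{-1}$. Localized $K$-theory. $K_T^{loc}(-)=K_T(-)\otimes_{R(T)}\mathcal{R}$, where $\mathcal{R}\cong\mathbb{Q}(t_1,\dots,t_n)$ is the fraction field of $R(T)$ and $t_1,\dots,t_n$ are the characters of $T$. By localization, $K_T^{loc}(X)\cong K_T^{loc}(X^T)$ for $X=Gr(r,n)$ or $Gr(n-r,n)$,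 so a class is determined by its restrictions to the isolated $T$-fixed points. Let $[n]=\{1,\dots,n\}$, let $e_1,\dots,e_n$ be the basis of $\mathbb{C}^n$ and $e^1,\dots,e^n$ the dual basis. The fixed points of $Gr(r,n)$ are the subspaces $\langle e_j\rangle_{j\in I}$ with $I\subset[n]$, $|I|=r$; those of $Gr(n-r,n)$ are $\langle e^j\rangle_{j\in J}$ with $|J|=n-r$. The isomorphism $K_T^{loc}(Gr(r,n))\cong K_T^{loc}(Gr(n-r,n))$ is the one induced by the identification of fixed points $\langle e_j\rangle_{j\in I}\mapsto\langle e^j\rangle_{j\in I^\complement}$, where $I^\complement=[n]\setminus I$ (this comes from the equivariant isomorphism $Gr(r,V)\cong Gr(n-r,V^* )$, $W\mapsto (V/W)^*$). Tautological classes. $L_1,\dots,L_r$ come from the filtration of the tautological bundle $\mathcal{S}_r$ of $Gr(r,n)$ (its $K$-theoretic Chern roots); at the fixed point indexed by $I$ they restrict to $\{\Lambda_i\}_{i\in I}$ (in any order). Likewise $\tilde L_1,\dots,\tilde L_{n-r}$ come from the filtration of the tautological bundle $\mathcal{S}_{n-r}$ of $Gr(n-r,n)$, restricting to $\{\Lambda_i^{-1}\}_{i\in I^\complement}$ at the fixed point indexed by $I^\complement$. $\bigwedge^{top}$ denotes the top exterior power (determinant line bundle). $I$-functions. The coefficients of the equivariant small quasimap $I$-functions with level structure are $$I^{Gr(r,n),E_r,l}_{T,d}=\sum_{d_1+\cdots+d_r=d}\ \prod_{i,j=1}^r\frac{\prod_{k=-\infty}^{d_i-d_j}(1-q^kL_iL_j^{-1})}{\prod_{k=-\infty}^{0}(1-q^kL_iL_j^{-1})}\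 \prod_{i=1}^r\frac{\left(L_i^{d_i}q^{d_i(d_i-1)/2}\right)^l}{\prod_{k=1}^{d_i}\prod_{m=1}^n(1-q^kL_i\Lambda_m^{-1})},$$ $$I^{Gr(n-r,n),E_{n-r}^\vee,-l}_{T,d}=\sum_{d_1+\cdots+d_{n-r}=d}\ \prod_{i,j=1}^{n-r}\frac{\prod_{k=-\infty}^{d_i-d_j}(1-q^k\tilde L_i\tilde L_j^{-1})}{\prod_{k=-\infty}^{0}(1-q^k\tilde L_i\tilde L_j^{-1})}\ \prod_{i=1}^{n-r}\frac{\left(\tilde L_i^{d_i}q^{d_i(d_i+1)/2}\right)^{-l}}{\prod_{k=1}^{d_i}\prod_{m=1}^n(1-q^k\tilde L_i\Lambda_m)},$$ where the sums run over tuples of non-negative integers. The ratio $\prod_{k=-\infty}^{a}(1-q^kx)/\prod_{k=-\infty}^{0}(1-q^kx)$ means $\prod_{k=1}^{a}(1-q^kx)$ if $a\ge 0$ and $1/\prod_{k=a+1}^{0}(1-q^kx)$ if $a<0$. For $d=0$ both coefficients equal $1$. These sums are symmetric in the $L_i$ (resp. $\tilde L_i$), and their restrictions to fixed points are obtained by substituting, in any order, $\{\Lambda_i\}_{i\in I}$ for $L_1,\dots,L_r$ at the fixed point $\langle e_j\rangle_{j\in I}$ of $Gr(r,n)$, and $\{\Lambda_i^{-1}\}_{i\in I^\complement}$ for $\tilde L_1,\dots,\tilde L_{n-r}$ at the fixed point $\langle e^j\rangle_{j\in I^\complement}$ of $Gr(n-r,n)$. *)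

(* Defs.v *)
From HB Require Import structures.
From mathcomp Require Import all_boot all_order all_algebra.
From mathcomp Require Import reals.
From mathcomp Require Import complex.
From mathcomp Require Import mpoly.

Set Implicit Arguments.
Unset Strict Implicit.
Unset Printing Implicit Defensive.

Import Order.TTheory GRing.Theory Num.Theory.
Local Open Scope ring_scope.

(* C(q)(t_1, ..., t_n) with C = R[i]: the fraction field R of R(T) = Z[t^+-1],
   tensored with C(q) and localized further, so that the factors
   1 - q^k L_i / L_j occurring in the I-functions are invertible. *)
Definition Cq (R : realType) : fieldType := {fraction {poly R[i]}}.

Definition KTpt (R : realType) (n : nat) : fieldType :=
  {fraction {mpoly (Cq R)[n]}}.

Definition qvar (R : realType) (n : nat) : KTpt R n :=
  tofrac ((tofrac 'X : Cq R)%:MP_[n]).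

(* The weight Lambda_i, i.e. the character t_i; indices start at 0. *)
Definition Lambda (R : realType) (n : nat) (i : 'I_n) : KTpt R n :=
  tofrac ('X_i : {mpoly (Cq R)[n]}).

Arguments Lambda : clear implicits.

(* T-fixed points of Gr(r, n): I stands for <e_j>_(j in I), resp. <e^j>_(j in I)
   for the dual action. *)
Definition fixpt (r n : nat) := {I : {set 'I_n} | #|I| == r}.

(* Localized equivariant K-theory of Gr(r, n), through the localization
   isomorphism: a class is the family of its restrictions to the fixed points,
   and sums and products are pointwise. *)
Definition KTloc (F : fieldType) (r n : nat) := {ffun fixpt r n -> F}.

Lemma fixpt_compl_subproof (r n : nat) (I : fixpt r n) :
  #|~: val I| == (n - r)%N.
Proof. by rewrite cardsCs setCK card_ord (eqP (valP I)). Qed.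

Definition fixpt_compl (r n : nat) (I : fixpt r n) : fixpt (n - r) n :=
  exist (fun J : {set 'I_n} => #|J| == (n - r)%N) (~: val I)
    (fixpt_compl_subproof I).

Definition KTdual (F : fieldType) (r n : nat) (f : KTloc F (n - r) n) :
    KTloc F r n :=
  [ffun I => f (fixpt_compl I)].

Lemma fixpt_compl_bij (r n : nat) : (r <= n)%N -> bijective (@fixpt_compl r n).
Proof.
move=> le_rn.
have cardJ (J : fixpt (n - r) n) : #|~: val J| == r.
  by rewrite cardsCs setCK card_ord (eqP (valP J)) subKn.
exists (fun J => exist (fun I : {set 'I_n} => #|I| == r) (~: val J) (cardJ J)).
  by move=> I; apply: val_inj; rewrite /= setCK.
by move=> J; apply: val_inj; rewrite /= setCK.
Qed.

Section IFunctions.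
Variables (F : fieldType) (q : F).

Definition qpoch (a : F) (d : nat) : F := \prod_(k < d) (1 - q ^+ k * a).

(* prod_(k = -oo)^a (1 - q^k x) / prod_(k = -oo)^0 (1 - q^k x).
   Negz b is a = - (b + 1), where the inverted product is over -b <= k <= 0. *)
Definition qratio (x : F) (a : int) : F :=
  match a with
  | Posz b => \prod_(1 <= k < b.+1) (1 - q ^+ k * x)
  | Negz b => (\prod_(0 <= k < b.+1) (1 - q ^- k * x))^-1
  end.

Variable n : nat.
Variable Lam : 'I_n -> F.

(* Degree d coefficient for Gr(r, n), E_r, level l, in the Chern roots L.  The
   parts of a composition of d are at most d, hence the type of e. *)
Definition Icoef (r : nat) (l : int) (d : nat) (L : 'I_r -> F) : F :=
  \sum_(e : {ffun 'I_r -> 'I_d.+1} | (\sum_i e i)%N == d)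
    (\prod_i \prod_j qratio (L i / L j) ((e i)%:Z - (e j)%:Z)) *
    \prod_i ((L i ^+ e i * q ^+ ((e i * (e i).-1) %/ 2)) ^ l /
             \prod_(1 <= k < (e i).+1) \prod_m (1 - q ^+ k * L i * (Lam m)^-1)).

(* Same for the dual action on Gr(r, n), with E_r^vee and level l. *)
Definition Icoef_dual (r : nat) (l : int) (d : nat) (L : 'I_r -> F) : F :=
  \sum_(e : {ffun 'I_r -> 'I_d.+1} | (\sum_i e i)%N == d)
    (\prod_i \prod_j qratio (L i / L j) ((e i)%:Z - (e j)%:Z)) *
    \prod_i ((L i ^+ e i * q ^+ ((e i * (e i).+1) %/ 2)) ^ l /
             \prod_(1 <= k < (e i).+1) \prod_m (1 - q ^+ k * L i * Lam m)).

(* Restrictions of the Chern roots to a fixed point, in increasing order of the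
   indices; [Icoef] and [Icoef_dual] are symmetric in the Chern roots. *)
Definition fixpt_nth (r : nat) (I : fixpt r n) (i : 'I_r) : 'I_n :=
  enum_val (cast_ord (esym (eqP (valP I))) i).

Definition root_at (r : nat) (I : fixpt r n) (i : 'I_r) : F :=
  Lam (fixpt_nth I i).

Definition root_dual_at (r : nat) (I : fixpt r n) (i : 'I_r) : F :=
  (Lam (fixpt_nth I i))^-1.

Definition IGr (r : nat) (l : int) (d : nat) : KTloc F r n :=
  [ffun I => Icoef l d (root_at I)].

Definition IGr_dual (r : nat) (l : int) (d : nat) : KTloc F r n :=
  [ffun I => Icoef_dual l d (root_dual_at I)].

(* The class of the top exterior power of the tautological bundle. *)
Definition detS (r : nat) : KTloc F r n :=
  [ffun I => \prod_i root_at I i].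

Definition detS_dual (r : nat) : KTloc F r n :=
  [ffun I => \prod_i root_dual_at I i].

(* C_s(k, d) and D_s(k, d), with W the determinant class in the denominator. *)
Definition Ccoef (r : nat) (W : KTloc F r n) (s k d : nat) : KTloc F r n :=
  [ffun I => (-1) ^+ (k * s) /
             (qpoch q s * q ^+ (s * (d - s + k)) * W I ^+ s)].

Definition Dcoef (r : nat) (W : KTloc F r n) (s k d : nat) : KTloc F r n :=
  [ffun I => (-1) ^+ (k * s) /
             (qpoch q s * q ^+ (s * (d - s)) * W I ^+ s)].

Lemma sum_ffun_ord1 (r : nat) (G : {ffun 'I_r -> 'I_1} -> F) :
  \sum_(e : {ffun 'I_r -> 'I_1} | (\sum_i e i)%N == 0%N) G e
  = G [ffun=> ord0].
Proof.
rewrite (bigD1 [ffun=> ord0]) /=; last by rewrite big1 // => i _; rewrite ffunE.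
rewrite big1 ?addr0 // => e /andP[_ /eqP[]].
by apply/ffunP => i; rewrite ffunE; apply: ord1.
Qed.

Lemma IGr0 (r : nat) (l : int) : IGr r l 0 = 1.
Proof.
apply/ffunP => I; rewrite !ffunE /Icoef sum_ffun_ord1.
rewrite big1 ?mul1r => [|i _]; last first.
  by rewrite big1 // => j _; rewrite !ffunE subrr /= big_geq.
by rewrite big1 // => i _; rewrite ffunE /= mulr1 exp1rz big_geq // divr1.
Qed.

Lemma IGr_dual0 (r : nat) (l : int) : IGr_dual r l 0 = 1.
Proof.
apply/ffunP => I; rewrite !ffunE /Icoef_dual sum_ffun_ord1.
rewrite big1 ?mul1r => [|i _]; last first.
  by rewrite big1 // => j _; rewrite !ffunE subrr /= big_geq.
by rewrite big1 // => i _; rewrite ffunE /= mulr1 exp1rz big_geq // divr1.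
Qed.

End IFunctions.

Arguments IGr {F} q {n} Lam r l d.
Arguments IGr_dual {F} q {n} Lam r l d.
Arguments detS {F n} Lam r.
Arguments detS_dual {F n} Lam r.
Arguments Ccoef {F} q {n r} W s k d.
Arguments Dcoef {F} q {n r} W s k d.

(* Main.v *)
(* At the fixed point I, write x for the weights indexed by I and y for the
   others; the two sides are sums over compositions of d into parts indexed by
   I, resp. by its complement, which we view as columns of boxes.  Removing the
   last box of a column of the left sum, weighted so that the weights add up to
   1 - q^d, leaves a sum of residues in one variable; moving it to the other
   poles y_b / q gives

     (1 - q^d) S_d(x, y) = sum_b a_b S_(d-1)(x, y with y_b replaced by y_b / q)

   plus, when l = n - r, a residue at infinity which is a multiple of
   S_(d-1)(x, y).  Removing instead the first box of a column of the dual sum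
   gives the same recursion, with the same a_b and without the residue at
   infinity.  Since x and y are arbitrary, induction on d concludes for
   1 - r <= l <= n - r - 1; for l = n - r the coefficients C_s are exactly what
   solves the inhomogeneous recursion, and the case l = -r is the case l = n - r
   of the dual Grassmannian. *)
Require Import Defs.
From mathcomp Require Import all_boot all_order all_algebra.
From mathcomp Require Import reals.
From mathcomp Require Import complex mpoly ring zify.

Set Implicit Arguments.
Unset Strict Implicit.
Unset Printing Implicit Defensive.

Import Order.TTheory GRing.Theory Num.Theory.
Local Open Scope ring_scope.

(** * Compositions as column heights, and the removal of a box *)

Section Compositions.
Variable A : finType.

(** Heights are natural numbers rather than elements of ['I_d.+1], so that [addbox] and the passage
    from [d] to [d.+1] stay within one type. *)
Definition compositions (d : nat) : seq {ffun A -> nat} :=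
  [seq [ffun i => val (e i)]
  | e : {ffun A -> 'I_d.+1} <- enum {: {ffun A -> 'I_d.+1}} & (\sum_i e i)%N == d].

Lemma mem_compositions d (e : {ffun A -> nat}) :
  (e \in compositions d) = ((\sum_i e i)%N == d).
Proof.
apply/mapP/idP => [[f] | sum_e].
  rewrite mem_filter => /andP[sum_f _] ->; rewrite -[X in _ == X](eqP sum_f).
  by apply/eqP/eq_bigr => i _; rewrite ffunE.
have le_ed i : (e i < d.+1)%N.
  by rewrite ltnS -(eqP sum_e) (bigD1 i) //= leq_addr.
exists [ffun i => Ordinal (le_ed i)]; last by apply/ffunP => i; rewrite !ffunE.
rewrite mem_filter mem_enum andbT -[X in _ == X](eqP sum_e).
by apply/eqP/eq_bigr => i _; rewrite ffunE.
Qed.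

Lemma compositions_uniq d : uniq (compositions d).
Proof.
rewrite map_inj_uniq => [|e f /ffunP eq_ef].
  by rewrite filter_uniq -?enumT ?enum_uniq.
by apply/ffunP => i; apply: val_inj; have:= eq_ef i; rewrite !ffunE.
Qed.

Definition addbox (i : A) (e : {ffun A -> nat}) : {ffun A -> nat} :=
  [ffun j => (e j + (j == i))%N].

Lemma addbox_inj i : injective (addbox i).
Proof.
move=> e f /ffunP eq_ef; apply/ffunP => j.
by have:= eq_ef j; rewrite !ffunE => /addIn.
Qed.

Lemma sum_addbox i e : (\sum_j addbox i e j = (\sum_j e j).+1)%N.
Proof.
under eq_bigr do rewrite ffunE.
rewrite big_split /= [X in (_ + X)%N = _](bigD1 i) //= eqxx.
by rewrite [X in (true + X)%N]big1 ?addn0 ?addn1 // => j /negPf->.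
Qed.

(** Removing a box from a nonempty column [i] is a bijection onto the compositions of [d], with
    inverse [addbox i]. *)
Lemma big_compositionsS (V : nmodType) d (i : A) (G : {ffun A -> nat} -> V) :
  \sum_(e <- compositions d.+1 | (0 < e i)%N) G e =
  \sum_(e <- compositions d) G (addbox i e).
Proof.
rewrite -big_filter -(big_map (addbox i) predT G).
apply/perm_big/uniq_perm; rewrite ?filter_uniq ?compositions_uniq //.
  by rewrite map_inj_uniq ?compositions_uniq //; apply: addbox_inj.
move=> e; rewrite mem_filter mem_compositions.
apply/andP/mapP => [[e_gt0 /eqP sum_e] | [f]]; last first.
  rewrite mem_compositions => /eqP sum_f ->.
  by rewrite sum_addbox sum_f !ffunE eqxx addn1.
pose f : {ffun A -> nat} := [ffun j => (e j - (j == i))%N].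
have ef : e = addbox i f.
  apply/ffunP => j; rewrite !ffunE; case: eqP => [->|_]; last by rewrite subn0 addn0.
  by rewrite subnK.
exists f => //; rewrite mem_compositions -eqSS -sum_e.
by rewrite [in X in _ == X]ef sum_addbox.
Qed.

End Compositions.

(** * Lagrange interpolation and the residue identities *)

Section PartialFractions.
Variable F : fieldType.

(** Each Lagrange basis polynomial [L k] is monic of degree [#|K|.-1], so the top coefficient of [p]
    is the sum of its coordinates [c k]. *)
Lemma lagrange_lead (K : finType) (z : K -> F) (p : {poly F}) :
  injective z -> (size p <= #|K|)%N ->
  \sum_k p.[z k] / \prod_(j | j != k) (z k - z j) = p`_(#|K|.-1).
Proof.
move=> z_inj sz_p.
have dz k j : j != k -> z k - z j != 0.
  by move=> ne_jk; rewrite subr_eq0 (inj_eq z_inj) eq_sym.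
pose L k : {poly F} := \prod_(j | j != k) ('X - (z j)%:P).
have LE k : L k = \prod_(w <- [seq z j | j <- enum (predC1 k)]) ('X - w%:P).
  by rewrite big_map big_enum.
have szL k : size (L k) = #|K|.
  rewrite LE size_prod_XsubC size_map -cardE cardC1 prednK //.
  by apply/card_gt0P; exists k.
have lcL k : (L k)`_(#|K|.-1) = 1.
  rewrite -(szL k) -lead_coefE; apply/eqP; rewrite -monicE.
  by apply: monic_prod => j _; apply: monicXsubC.
have Lz k : (L k).[z k] = \prod_(j | j != k) (z k - z j).
  by rewrite horner_prod; apply: eq_bigr => j _; rewrite hornerXsubC.
have Lz0 k j : j != k -> (L k).[z j] = 0.
  move=> ne_jk; rewrite horner_prod (bigD1 j) //= hornerXsubC subrr mul0r //.
pose c k := p.[z k] / \prod_(j | j != k) (z k - z j).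
(* Both sides have size at most [#|K|] and agree at the [#|K|] distinct points [z k]. *)
have -> : p = \sum_k c k *: L k.
  apply/eqP; rewrite -subr_eq0; apply/eqP.
  apply: (@roots_geq_poly_eq0 _ _ [seq z k | k <- enum K]).
  - apply/allP => _ /mapP[k _ ->]; rewrite rootE hornerD hornerN horner_sum.
    rewrite (bigD1 k) //= big1 => [|j ne_jk]; last first.
      by rewrite hornerZ Lz0 ?mulr0 // eq_sym.
    rewrite addr0 hornerZ Lz divfK ?subrr //.
    by apply/prodf_neq0 => j; apply: dz.
  - by rewrite map_inj_uniq ?enum_uniq.
  rewrite size_map -cardE (leq_trans (size_polyD _ _)) // geq_max sz_p size_polyN.
  apply: (leq_trans (size_sum _ _ _)); apply/bigmax_leqP => k _.
  by rewrite (leq_trans (size_scale_leq _ _)) ?szL.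
rewrite coef_sum; apply: eq_bigr => k _; rewrite coefZ lcL mulr1.
congr (_ / _); rewrite horner_sum (bigD1 k) //= big1 => [|j ne_jk].
  rewrite addr0 hornerZ Lz divfK //.
  by apply/prodf_neq0 => j; apply: dz.
by rewrite hornerZ Lz0 ?mulr0 // eq_sym.
Qed.

(* Interpolates [\prod_j (1 - z / x_j)] at [0] and the [X_i]. *)
Lemma sum_box_weights (A : finType) (x X : A -> F) :
  injective X -> (forall i, x i != 0) -> (forall i, X i != 0) ->
  \sum_i \prod_j (1 - X i / x j) / \prod_(j | j != i) (1 - X i / X j)
  = 1 - \prod_j (X j / x j).
Proof.
move=> X_inj x0 X0.
pose z (k : 'I_1 + A) := if k is inr i then X i else 0.
pose p : {poly F} := \prod_j (1 - (x j)^-1 *: 'X).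
have z_inj : injective z.
  move=> [k|i] [k'|j] //=; last by move/X_inj->.
  - by rewrite !ord1.
  - by move=> /esym/eqP; rewrite (negPf (X0 j)).
  by move=> /eqP; rewrite (negPf (X0 i)).
have pE : p = \prod_j (- x j)^-1 *: \prod_(w <- [seq x j | j <- enum A]) ('X - w%:P).
  rewrite big_map big_enum /= -scaler_prod; apply: eq_bigr => j _.
  by rewrite scalerBr scale_polyC invrN mulNr mulVf // polyCN opprK scaleNr addrC.
have szp : (size p <= #|A|.+1)%N.
  by rewrite pE (leq_trans (size_scale_leq _ _)) // size_prod_XsubC size_map -cardE.
have lcp : p`_#|A| = \prod_j (- x j)^-1.
  rewrite pE coefZ -[X in _`_X](_ :
      (size (\prod_(w <- [seq x j | j <- enum A]) ('X - w%:P))).-1 = _).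
    by rewrite -lead_coefE (eqP (monic_prod_XsubC _ _ _)) mulr1.
  by rewrite size_prod_XsubC size_map -cardE.
have pz t : p.[t] = \prod_j (1 - t / x j).
  rewrite horner_prod; apply: eq_bigr => j _.
  by rewrite hornerD hornerN hornerZ hornerX hornerC mulrC.
have X0' : \prod_j - X j != 0 by apply/prodf_neq0 => j _; rewrite oppr_eq0.
have := @lagrange_lead _ z p z_inj; rewrite card_sum card_ord => /(_ szp) /=.
rewrite lcp big_sumType big_ord1 /= pz.
rewrite big1 ?mul1r => [|j _]; last by rewrite mul0r subr0.
rewrite big_sumType /= big1 ?mul1r => [|k]; last by rewrite ord1.
under [X in X^-1]eq_bigr do rewrite sub0r.
under [in X in _ + X]eq_bigr => i _.
  rewrite pz big_sumType big_ord1_cond /= subr0.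
  over.
(* The node [0] contributes [1 / \prod_j - X j]; clearing it turns this term into 1 and the leading
   coefficient into [\prod_j (X j / x j)]. *)
move=> /(congr1 (fun t => \prod_j - X j * t)).
rewrite mulrDr ?div1r divff // -big_split /= => E.
have -> : \prod_j (X j / x j) = \prod_j (- X j / - x j).
  by apply: eq_bigr => j _; rewrite invrN mulrNN.
rewrite -E opprD addNKr -mulNr mulr_sumr; apply: eq_bigr => i _.
have -> : X i * \prod_(j | (inr j : 'I_1 + A) != inr i) (X i - X j) =
          - (\prod_j - X j) * \prod_(j | j != i) (1 - X i / X j).
  rewrite [in RHS](bigD1 i) //= -mulNr opprK -mulrA -big_split /=; congr (_ * _).
  apply: eq_big => [j|j ne_ji]; first by rewrite (inj_eq (@inr_inj _ _)).
  by rewrite mulrBr mulr1 mulrCA mulNr mulfV // mulrN1 opprK addrC.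
by rewrite invfM mulrCA mulVKf // oppr_eq0.
Qed.

(* Residues of [z^(l-1) / (\prod_j (1 - u_j / z) \prod_b (1 - z / v_b))]: the
   lower bound on [l] kills the residue at [0], and the one at infinity is
   nonzero only for [l = #|B|]. *)
Lemma sum_residues (A B : finType) (u : A -> F) (v : B -> F) (l : int) :
  injective u -> injective v -> (forall i b, u i != v b) ->
  (forall i, u i != 0) -> (forall b, v b != 0) ->
  1 - #|A|%:Z <= l <= #|B|%:Z ->
  \sum_i u i ^ l / (\prod_(j | j != i) (1 - u j / u i) * \prod_b (1 - u i / v b))
  = \sum_b v b ^ l / (\prod_j (1 - u j / v b) * \prod_(c | c != b) (1 - v b / v c))
    + (l == #|B|%:Z)%:R * \prod_b - v b.
Proof.
move=> u_inj v_inj uv u0 v0 /andP[l_ge l_le].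
(* The monomial ['X^k] is interpolated at all [u i] and [v b]. The lower bound on [l] makes [k] a
   natural number, the upper bound keeps its degree below the number of nodes. *)
have [k lE] : exists k : nat, l = k%:Z + 1 - #|A|%:Z.
  by exists (absz (l - 1 + #|A|%:Z)); lia.
pose z (k : A + B) := match k with inl i => u i | inr b => v b end.
have z_inj : injective z.
  move=> [i|b] [j|c] //= E; first by rewrite (u_inj _ _ E).
  - by have := uv i c; rewrite E eqxx.
  - by have := uv j b; rewrite E eqxx.
  by rewrite (v_inj _ _ E).
have szp : (size ('X^k : {poly F}) <= #|{: A + B}|)%N.
  by rewrite size_polyXn card_sum; lia.
have V0 : \prod_b - v b != 0 by apply/prodf_neq0 => b _; rewrite oppr_eq0.
(* Two normalizations of the Lagrange denominators: [powE] factors [t] out of each difference,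
   [subE] factors out [- w j]. *)
have powE (I : finType) (P : pred I) (t : F) (w : I -> F) : t != 0 ->
    \prod_(j | P j) (t - w j) = t ^+ #|P| * \prod_(j | P j) (1 - w j / t).
  move=> t0; rewrite -prodr_const -big_split /=; apply: eq_bigr => j _.
  by rewrite mulrBr mulr1 mulrCA mulfV // mulr1.
have subE (I : finType) (P : pred I) (t : F) (w : I -> F) : (forall j, w j != 0) ->
    \prod_(j | P j) (t - w j) = \prod_(j | P j) (- w j) * \prod_(j | P j) (1 - t / w j).
  move=> w0; rewrite -big_split /=; apply: eq_bigr => j _.
  by rewrite mulrBr mulr1 mulrCA mulNr mulfV // mulrN1 opprK addrC.
have kE (t : F) : t != 0 -> t ^+ k * t = t ^ l * t ^+ #|A|.
  by move=> t0; rewrite -exprSr (exprnP t #|A|) -expfzDr // exprnP; congr (_ ^ _); lia.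
have := @lagrange_lead _ z _ z_inj szp.
rewrite coefXn big_sumType card_sum /=.
under eq_bigr => i _ do rewrite big_sumType /= hornerXn.
under [in X in _ + X = _]eq_bigr => b _ do rewrite big_sumType /= hornerXn.
have -> : ((#|A| + #|B|).-1 == k) = (l == #|B|%:Z) by lia.
move=> <-; rewrite mulrDl addrC !mulr_suml -[LHS]addr0 -addrA; congr (_ + _).
  apply: eq_bigr => i _.
  rewrite [X in _ = _ / (X * _) * _](eq_bigl (predC1 i)) => [|j]; last first.
    by rewrite /= (inj_eq (@inl_inj _ _)).
  rewrite (powE _ _ (u i) u) // (subE _ _ (u i) v) // cardC1.
  have A_gt0 : (0 < #|A|)%N by apply/card_gt0P; exists i.
  have := kE _ (u0 i); rewrite -[in X in _ = X](prednK A_gt0) exprSr mulrA.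
  move=> /(mulIf (u0 i)) ->; rewrite !invfM.
  move: (_^-1) (_^-1) => P Q; field.
  by rewrite V0 expf_neq0.
symmetry; apply/eqP; rewrite addrC addr_eq0 -sumrN; apply/eqP/eq_bigr => b _.
rewrite [X in - (_ / (_ * X) * _)](eq_bigl (predC1 b)) => [|c]; last first.
  by rewrite /= (inj_eq (@inr_inj _ _)).
rewrite (powE _ _ (v b) u) // (subE _ _ (v b) v) // cardT -cardE /= !invfM.
rewrite [X in _ = - (_ * X)](bigD1 b) //=.
have nzb : \prod_(c | c != b) - v c != 0.
  by apply/prodf_neq0 => c _; rewrite oppr_eq0.
have vA0 := expf_neq0 #|A| (v0 b); have vb0 := v0 b.
have -> : v b ^+ k = v b ^ l * v b ^+ #|A| / v b by rewrite -kE // mulfK.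
move: (\prod_j (1 - u j / _))^-1 (\prod_(c | _) (1 - _ / v c))^-1 => P Q.
by field; rewrite nzb vA0 vb0.
Qed.

End PartialFractions.

(** * Products whose factors change only at one index *)

Section Products.
Variables (F : fieldType) (A : finType).

Lemma prod_ratio (G G' : A -> F) (i : A) (c : F) :
  G i = c * G' i -> (forall j, j != i -> G j = G' j) ->
  \prod_j G j = c * \prod_j G' j.
Proof.
move=> Gi Gj; rewrite (bigD1 i) //= [in RHS](bigD1 i) //= Gi -mulrA.
by congr (_ * (_ * _)); apply: eq_bigr.
Qed.

(** A new box in column [i] affects only the pairs containing [i]: [c0] accounts for the diagonal
    pair, [c1] for row [i] and [c2] for column [i]. *)
Lemma prod_cross_ratio (G G' : A -> A -> F) (i : A) (c0 : F) (c1 c2 : A -> F) :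
  G i i = c0 * G' i i ->
  (forall j, j != i -> G i j = c1 j * G' i j) ->
  (forall j, j != i -> G j i = c2 j * G' j i) ->
  (forall k j, k != i -> j != i -> G k j = G' k j) ->
  \prod_k \prod_j G k j =
  c0 * \prod_(j | j != i) (c1 j * c2 j) * \prod_k \prod_j G' k j.
Proof.
move=> Gii Gij Gji Gkj; rewrite [in RHS]big_split /=.
rewrite (bigD1 i) //= [X in _ = _ * X](bigD1 i) //= [X in X * _ = _](bigD1 i) //=.
rewrite [X in _ = _ * (X * _)](bigD1 i) //= Gii (eq_bigr _ Gij) big_split /=.
have -> : \prod_(k | k != i) \prod_j G k j =
          \prod_(k | k != i) c2 k * \prod_(k | k != i) \prod_j G' k j.
  rewrite -big_split /=; apply: eq_bigr => k ne_ki.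
  rewrite (bigD1 i) //= [in RHS](bigD1 i) //= Gji // -!mulrA.
  by congr (_ * (_ * _)); apply: eq_bigr => j; apply: Gkj.
ring.
Qed.

End Products.

(** * Extending a [q]-ratio at either end *)

Section QRatio.
Variables (F : fieldType) (q : F).
Hypothesis q0 : q != 0.

Lemma qratioSr (x : F) (a : int) :
  1 - q ^ (a + 1) * x != 0 ->
  qratio q x (a + 1) = (1 - q ^ (a + 1) * x) * qratio q x a.
Proof.
case: a => [b | [|b]] nz.
- by rewrite -PoszD addn1 /= big_nat_recr //= mulrC.
- by move: nz; rewrite /= big_geq // big_nat1 expr0 invr1 !mul1r => /mulfV.
have -> : Negz b.+1 + 1 = Negz b by lia.
rewrite /= [X in _ = _ * X^-1]big_nat_recr //= invfM mulrCA.
have -> : q ^ (Negz b) = q ^- b.+1 by [].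
rewrite mulfV ?mulr1 //.
by move: nz; have -> : Negz b.+1 + 1 = Negz b by lia.
Qed.

(** Every factor that can occur in [qratio q x a] is invertible, whatever the sign of [a]. *)
Definition qregular (x : F) := forall k : int, 1 - q ^ k * x != 0.

Lemma qregularZ x (m : int) : qregular x -> qregular (q ^ m * x).
Proof. by move=> reg_x k; rewrite mulrA -expfzDr. Qed.

(** By [qratioSr], raising [a] by one multiplies both sides by the same nonzero factor. The identity
    thus propagates in both directions from [a = 0]. *)
Lemma qratioSl (x : F) (a : int) : qregular x ->
  qratio q x (a + 1) = (1 - q * x) * qratio q (q * x) a.
Proof.
move=> reg_x.
have reg_qx : qregular (q * x) by apply: (@qregularZ x 1).
have step b : qratio q x (b + 1) = (1 - q * x) * qratio q (q * x) b <->
    qratio q x (b + 1 + 1) = (1 - q * x) * qratio q (q * x) (b + 1).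
  rewrite (@qratioSr x (b + 1)) // (@qratioSr (q * x) b) //.
  have -> : q ^ (b + 1) * (q * x) = q ^ (b + 1 + 1) * x.
    by rewrite [in RHS]expfzDr // expr1z mulrA.
  rewrite mulrCA; split=> [->//|].
  exact/mulfI/reg_x.
case: a => [a|a].
  elim: a => [|a IHa]; first by rewrite add0r /= big_nat1 big_geq // mulr1 expr1.
  have -> : Posz a.+1 = Posz a + 1 by lia.
  exact: (step _).1.
elim: a => [|a IHa].
  by apply: (step _).2; rewrite /= big_nat1 big_geq // mulr1 expr1.
by apply: (step _).2; have -> : Negz a.+1 + 1 = Negz a by lia.
Qed.

Lemma qratio_neq0 x a : qregular x -> qratio q x a != 0.
Proof.
move=> reg_x; case: a => a /=; rewrite ?invr_eq0 prodf_seq_neq0;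
apply/allP => k _ /=; first exact: (reg_x k).
by have := reg_x (- k%:Z); rewrite -exprnN.
Qed.

End QRatio.


(** * Weights that are generic modulo powers of [q] *)

Section Vortex.
Variables (F : fieldType) (q : F).
Hypothesis q0 : q != 0.

(* The case [i = j] says that [z] is nowhere zero and [q] is not a root of unity. *)
Definition qseparated (K : Type) (z : K -> F) :=
  forall i j (k : int), z i = q ^ k * z j -> i = j /\ k = 0.

Definition qdisjoint (A B : Type) (x : A -> F) (y : B -> F) :=
  forall i b (k : int), x i != q ^ k * y b.

Lemma qseparated_neq0 (C : Type) (z : C -> F) :
  qseparated z -> forall c, z c != 0.
Proof.
move=> z_sep c; apply/eqP => zc0.
by have [|_] := z_sep c c 1; rewrite // zc0 mulr0.
Qed.

Definition qshift (K : eqType) (m : int) (i : K) (z : K -> F) (j : K) : F :=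
  if j == i then q ^ m * z j else z j.

Lemma expz_subnat (a b : nat) : q ^ (a%:Z - b%:Z) = q ^+ a / q ^+ b.
Proof. by rewrite expfzDr // -exprnN. Qed.

(** * Vortex sums and their two box-removal recursions *)

Section Terms.
Variables (A B : finType).
Implicit Types (x : A -> F) (y : B -> F) (e : {ffun A -> nat}).

(* [y] stands for the weights outside the fixed point: the product over all
   [Lambda_m] in the denominator of the I-function is split into the weights
   [x j], moved into the first factor, and the weights [y b]. *)
Definition vterm x y (l : int) e : F :=
  (\prod_i \prod_j (qratio q (x i / x j) ((e i)%:Z - (e j)%:Z) /
                    qratio q (x i / x j) (e i))) *
  \prod_i (x i ^+ e i * q ^+ 'C(e i, 2)) ^ l /
  \prod_i \prod_b qratio q (x i / y b) (e i).

Section Separated.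
Variable x : A -> F.
Hypothesis x_sep : qseparated x.

Lemma qseparated_regular (i j : A) : i != j -> qregular q (x i / x j).
Proof.
move=> ne_ij k; apply/eqP => /eqP; rewrite subr_eq0 => /eqP E.
have [|e_ji _] := @x_sep j i k; last by rewrite e_ji eqxx in ne_ij.
by rewrite -[LHS]mul1r E mulrA divfK ?qseparated_neq0.
Qed.

Lemma qseparated_expn (i : A) k : (0 < k)%N -> 1 - q ^+ k != 0.
Proof.
move=> k_gt0; rewrite subr_eq0; apply/eqP => E.
have [|_ k0] := @x_sep i i k%:Z; first by rewrite -exprnP -E mul1r.
by case: k k0 k_gt0 {E}.
Qed.

Lemma qseparated_box_inj e : injective (fun i => x i * q ^+ e i).
Proof.
move=> i j E; have [] := @x_sep i j ((e j)%:Z - (e i)%:Z) => //.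
rewrite expfzDr // mulrAC -exprnN -exprnP.
by rewrite [_ * x j]mulrC -E mulfK // expf_neq0.
Qed.

End Separated.

Lemma qdisjoint_regular x y i b :
  (forall c, y c != 0) -> qdisjoint x y -> qregular q (x i / y b).
Proof.
move=> y0 xy k; apply/eqP => /eqP; rewrite subr_eq0 => /eqP E.
have /eqP[] := xy i b (- k).
rewrite -invr_expz; apply: (canRL (mulKf (expfz_neq0 k q0))).
by rewrite -[RHS]mul1r E mulrA divfK.
Qed.

(* The new box goes at the end of the [i]-th column. *)
Lemma vterm_last x y l e i : qseparated x -> qdisjoint x y ->
  (forall b, y b != 0) ->
  let u j := x j * q ^+ e j in
  vterm x y l (addbox i e) = vterm x y l e *
  (u i ^ l / \prod_j (1 - q * u i / x j) *
   \prod_(j | j != i) ((1 - q * u i / u j) / (1 - u j / u i)) /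
   \prod_b (1 - q * u i / y b)).
Proof.
move=> x_sep xy y0 u.
have x0 := qseparated_neq0 x_sep.
have qn0 n : q ^+ n != 0 by rewrite expf_neq0.
have uE j k : q ^ ((e j)%:Z - (e k)%:Z) * (x j / x k) = u j / u k.
  by rewrite expz_subnat /u; field; rewrite x0 qn0.
have uE1 j k : q ^ ((e j)%:Z - (e k)%:Z + 1) * (x j / x k) = q * u j / u k.
  by rewrite expfzDr // expr1z mulrAC uE mulrC mulrA.
have qrow t : q ^ ((e i)%:Z + 1) * (x i / t) = q * u i / t.
  by rewrite expfzDr // -exprnP expr1z /u !mulrA; congr (_ / _); ring.
have ui : u i = x i * q ^+ e i by [].
clearbody u; rewrite /vterm.
(* In row [i] both ratios gain a last factor. In column [i] only the numerator changes: its length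
   drops by one, which removes the factor [1 - u j / u i]. *)
rewrite (@prod_cross_ratio _ _ _
  (fun k j => qratio q (x k / x j) ((e k)%:Z - (e j)%:Z) / qratio q (x k / x j) (e k))
  i (1 - q * u i / x i)^-1
  (fun j => (1 - q * u i / u j) / (1 - q * u i / x j))
  (fun j => (1 - u j / u i)^-1)); first last.
- by move=> k j /negPf ki /negPf ji; rewrite !ffunE ki ji !addn0.
- move=> j ne_ji; have reg := qseparated_regular x_sep ne_ji.
  rewrite !ffunE eqxx (negPf ne_ji) addn0 addn1.
  have -> : (e j)%:Z - (e i)%:Z = ((e j)%:Z - (e i).+1%:Z) + 1 by lia.
  rewrite qratioSr // (_ : _ - _ + 1 = (e j)%:Z - (e i)%:Z); last by lia.
  rewrite uE !mulrA mulVf ?mul1r //.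
  by rewrite -uE.
- move=> j ne_ji; rewrite eq_sym in ne_ji.
  have reg := qseparated_regular x_sep ne_ji.
  rewrite !ffunE eqxx eq_sym (negPf ne_ji) addn0 addn1.
  have -> : (e i).+1%:Z - (e j)%:Z = ((e i)%:Z - (e j)%:Z) + 1 by lia.
  have -> : (e i).+1%:Z = (e i)%:Z + 1 by lia.
  rewrite !qratioSr // qrow uE1.
  by rewrite mulf_div.
- rewrite !ffunE eqxx !subrr addn1.
  have -> : Posz (e i).+1 = (e i)%:Z + 1 by lia.
  rewrite qratioSr //; last first.
    by rewrite divff // mulr1 expfzDr // -exprSr (qseparated_expn x_sep).
  by rewrite qrow invfM mulrCA.
(* Since ['C(m.+1, 2)] is ['C(m, 2) + m], the level factor grows by [(x i * q ^+ e i) ^ l]. *)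
rewrite (@prod_ratio _ _ (fun k => (x k ^+ addbox i e k * q ^+ 'C(addbox i e k, 2)) ^ l)
  (fun k => (x k ^+ e k * q ^+ 'C(e k, 2)) ^ l) i (u i ^ l));
  first last.
- by move=> j /negPf ji; rewrite ffunE ji addn0.
- rewrite ffunE eqxx addn1 binS bin1 addnC exprS exprD -expfzMl.
  by congr (_ ^ _); rewrite ui; ring.
rewrite (@prod_ratio _ _ (fun k => \prod_b qratio q (x k / y b) (addbox i e k))
  (fun k => \prod_b qratio q (x k / y b) (e k)) i (\prod_b (1 - q * u i / y b)));
  first last.
- by move=> j /negPf ji; rewrite ffunE ji addn0.
- rewrite ffunE eqxx -big_split; apply: eq_bigr => b _.
  have -> : Posz (e i + 1) = (e i)%:Z + 1 by lia.
  by rewrite qratioSr ?qrow // -qrow; apply: qdisjoint_regular.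
rewrite [\prod_j (1 - q * u i / x j)](bigD1 i) //=.
have -> : \prod_(j | j != i) ((1 - q * u i / u j) / (1 - q * u i / x j) / (1 - u j / u i)) =
   \prod_(j | j != i) ((1 - q * u i / u j) / (1 - u j / u i)) /
   \prod_(j | j != i) (1 - q * u i / x j).
  by rewrite -prodfV -big_split; apply: eq_bigr => j _; rewrite mulrAC.
rewrite !invfM.
move: (_^-1) (_^-1) (_^-1) (_^-1) => a1 a2 a3 a4; ring.
Qed.


(* The new box goes at the start of the [i]-th column: without it the column
   starts at [q * x i], and all the end points [X] are the same. *)
Lemma vterm_first x y l e i : qseparated x -> qdisjoint x y ->
  (forall b, y b != 0) ->
  let X j := x j * q ^+ addbox i e j in
  vterm x y l (addbox i e) = vterm (qshift 1 i x) y l e *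
  (x i ^ l / \prod_j (1 - X j / x i) / \prod_b (1 - q * x i / y b)).
Proof.
move=> x_sep xy y0 X.
have x0 := qseparated_neq0 x_sep.
have qn0 n : q ^+ n != 0 by rewrite expf_neq0.
pose x' := qshift 1 i x.
have x'i : x' i = q * x i by rewrite /x' /qshift eqxx.
have x'j j : j != i -> x' j = x j by rewrite /x' /qshift => /negPf->.
rewrite /vterm -/x'.
(* In row [i] numerator and denominator lose the same first factor, hence the constant 1. *)
rewrite (@prod_cross_ratio _ _ _
  (fun k j => qratio q (x' k / x' j) ((e k)%:Z - (e j)%:Z) / qratio q (x' k / x' j) (e k))
  i (1 - X i / x i)^-1 (fun=> 1) (fun j => (1 - X j / x i)^-1)); first last.
- by move=> k j ki ji; rewrite !x'j // !ffunE (negPf ki) (negPf ji) !addn0.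
- move=> j ne_ji; have reg := qseparated_regular x_sep ne_ji.
  rewrite /X !ffunE eqxx (negPf ne_ji) addn0 addn1 x'i x'j //.
  have zE : x j / x i = q * (x j / (q * x i)) by field; rewrite x0 q0.
  set z := x j / (q * x i) in zE *.
  have regz : qregular q z.
    have -> : z = q ^ (-1) * (x j / x i) by rewrite zE -invr_expz expr1z mulKf.
    exact: qregularZ.
  have -> : (e j)%:Z - (e i)%:Z = ((e j)%:Z - (e i).+1%:Z) + 1 by lia.
  rewrite qratioSl // -zE.
  (* Expanding the ratio of length [e j + 1] at [z] from both ends compares the denominators at
     [q * z] and at [z]. *)
  have := qratioSl q0 (e j) regz; rewrite qratioSr // -zE => E.
  have qE : q ^ ((e j)%:Z + 1) * z = x j * q ^+ e j / x i.
    by rewrite expfzDr // expr1z -mulrA -zE mulrCA mulrA.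
  rewrite qE in E.
  have nz1 : 1 - x j * q ^+ e j / x i != 0 by rewrite -qE.
  have nz2 : 1 - x j / x i != 0 by have := reg 0; rewrite expr0z mul1r.
  have nz3 := qratio_neq0 (e j) regz.
  have nz4 := qratio_neq0 (e j) reg.
  have -> : qratio q (x j / x i) (e j) =
     (1 - x j * q ^+ e j / x i) * qratio q z (e j) / (1 - x j / x i).
    by rewrite E mulrAC divff ?mul1r.
  move: (1 - _) (1 - x j / x i) nz1 nz2 {E nz4} => a b a0 b0.
  by field; rewrite a0 b0 nz3.
- move=> j ne_ji; rewrite mul1r; have ne_ij := ne_ji; rewrite eq_sym in ne_ij.
  have reg := qseparated_regular x_sep ne_ij.
  rewrite !ffunE eqxx (negPf ne_ji) addn0 addn1 x'i x'j // -mulrA.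
  have -> : (e i).+1%:Z - (e j)%:Z = ((e i)%:Z - (e j)%:Z) + 1 by lia.
  have -> : (e i).+1%:Z = (e i)%:Z + 1 by lia.
  rewrite !qratioSl // -mulf_div divff ?mul1r //.
  by have := reg 1; rewrite expr1z.
- rewrite /X !ffunE eqxx !subrr addn1 x'i !divff ?mulf_neq0 //.
  have -> : Posz (e i).+1 = (e i)%:Z + 1 by lia.
  rewrite qratioSr // mulr1; last by rewrite expfzDr // -exprSr (qseparated_expn x_sep).
  rewrite invfM mulrCA; congr ((1 - _)^-1 * _).
  by rewrite mulrAC divff // mul1r expfzDr // -exprSr.
(* The extra [q ^+ e i] is absorbed by [x' i = q * x i], so only [x i ^ l] remains. *)
rewrite (@prod_ratio _ _ (fun k => (x k ^+ addbox i e k * q ^+ 'C(addbox i e k, 2)) ^ l)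
  (fun k => (x' k ^+ e k * q ^+ 'C(e k, 2)) ^ l) i (x i ^ l));
  first last.
- by move=> j ji; rewrite x'j // ffunE (negPf ji) addn0.
- rewrite ffunE eqxx addn1 binS bin1 x'i -expfzMl exprS exprD exprMn.
  by congr (_ ^ _); ring.
rewrite (@prod_ratio _ _ (fun k => \prod_b qratio q (x k / y b) (addbox i e k))
  (fun k => \prod_b qratio q (x' k / y b) (e k)) i (\prod_b (1 - q * x i / y b)));
  first last.
- by move=> j ji; rewrite ffunE x'j // (negPf ji) addn0.
- rewrite ffunE eqxx -big_split x'i; apply: eq_bigr => b _.
  have -> : Posz (e i + 1) = (e i)%:Z + 1 by lia.
  by rewrite qratioSl -?mulrA //; apply: qdisjoint_regular.
rewrite [\prod_j (1 - X j / x i)](bigD1 i) //=.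
have -> : \prod_(j | j != i) (1 * (1 - X j / x i)^-1) =
   (\prod_(j | j != i) (1 - X j / x i))^-1.
  by rewrite -prodfV; apply: eq_bigr => j _; rewrite mul1r.
rewrite !invfM.
move: (_^-1) (_^-1) (_^-1) (_^-1) => a1 a2 a3 a4; ring.
Qed.

(** Distribute [1 - q ^+ d.+1] over the columns by the weights [W]. Empty columns have weight zero,
    so every surviving term comes from an [addbox]. *)
Lemma box_removal_sum d (W : A -> {ffun A -> nat} -> F) (G : {ffun A -> nat} -> F) :
  (forall e, \sum_i W i e = 1 - q ^+ (\sum_i e i)) ->
  (forall i e, e i = 0%N -> W i e = 0) ->
  (1 - q ^+ d.+1) * \sum_(e <- compositions A d.+1) G e =
  \sum_i \sum_(e <- compositions A d) W i (addbox i e) * G (addbox i e).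
Proof.
move=> sumW W0; rewrite mulr_sumr.
transitivity (\sum_(e <- compositions A d.+1) \sum_i W i e * G e).
  rewrite !big_seq; apply: eq_bigr => e; rewrite mem_compositions => /eqP <-.
  by rewrite -sumW mulr_suml.
rewrite exchange_big; apply: eq_bigr => i _.
rewrite -(big_compositionsS d i (fun e => W i e * G e)) [in RHS]big_mkcond /=.
apply: eq_bigr => e _.
by case: (posnP (e i)) => // /W0->; rewrite mul0r.
Qed.

Definition vsum x y (l : int) (d : nat) : F :=
  \sum_(e <- compositions A d) vterm x y l e.

(** The weights are chosen so that their numerator cancels the only factor of [vterm_first] that
    depends on [e]; the sum over [e] is then a shifted [vsum]. *)
Lemma vsum_first x y l d : qseparated x -> qdisjoint x y ->
  (forall b, y b != 0) ->
  (1 - q ^+ d.+1) * vsum x y l d.+1 =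
  \sum_i x i ^ l / (\prod_(j | j != i) (1 - x j / x i) * \prod_b (1 - q * x i / y b))
         * vsum (qshift 1 i x) y l d.
Proof.
move=> x_sep xy y0.
have x0 := qseparated_neq0 x_sep.
have qn0 n : q ^+ n != 0 by rewrite expf_neq0.
pose W i (e : {ffun A -> nat}) :=
  \prod_j (1 - x j * q ^+ e j / x i) / \prod_(j | j != i) (1 - x j / x i).
rewrite /vsum (@box_removal_sum d W) => [|e|i e ei0]; last 2 first.
(* The weights come from [sum_box_weights] with nodes [(x j)^-1] and zeros [(x j * q ^+ e j)^-1]. *)
- have -> : q ^+ (\sum_j e j) = \prod_j ((x j)^-1 / (x j * q ^+ e j)^-1).
    by rewrite expr_sum; apply: eq_bigr => j _; rewrite invrK mulKf.
  have inj_xV : injective (fun j => (x j)^-1).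
    by move=> j k /invr_inj jk; have [|] := x_sep j k 0; rewrite ?expr0z ?mul1r.
  rewrite -sum_box_weights // => [|j|j]; rewrite ?invr_eq0 ?mulf_neq0 //.
  apply: eq_bigr => i _; congr (_ / _); apply: eq_bigr => j _.
    by rewrite invrK mulrC.
  by rewrite invrK mulrC.
- rewrite /W (bigD1 i) //= ei0 expr0 mulr1 divff // subrr !mul0r //.
apply: eq_bigr => i _; rewrite mulr_sumr; apply: eq_bigr => e _.
rewrite vterm_first // /W.
have nz : \prod_j (1 - x j * q ^+ addbox i e j / x i) != 0.
  apply/prodf_neq0 => j _; have [->|ne_ji] := eqVneq j i.
    by rewrite mulrAC divff // mul1r ffunE eqxx addn1 (qseparated_expn x_sep).
  have := qseparated_regular x_sep ne_ji (addbox i e j).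
  by rewrite -exprnP mulrA [q ^+ _ * _]mulrC.
rewrite invfM.
move: (\prod_(j | j != i) _)^-1 (\prod_b (1 - q * _ / y b))^-1 (vterm _ _ _ _) nz => a b t nz.
by field.
Qed.

(** The extra denominator lengthens each ratio against [y b] by one factor at the end. Splitting off
    the first factor instead leaves a ratio of the old length against [y b / q]. *)
Lemma vterm_shift_pole x y l e b : qdisjoint x y -> (forall c, y c != 0) ->
  vterm x y l e / \prod_j (1 - q * (x j * q ^+ e j) / y b) =
  vterm x (qshift (-1) b y) l e / \prod_j (1 - q * x j / y b).
Proof.
move=> xy y0; rewrite /vterm -!mulrA; congr (_ * (_ * _)).
rewrite -!invfM -!big_split /=; congr _^-1; apply: eq_bigr => i _.
have reg := qdisjoint_regular i b y0 xy.
rewrite mulrC [RHS]mulrC (bigD1 b) //= [in RHS](bigD1 b) //= !mulrA.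
congr (_ * _); last first.
  by apply: eq_bigr => c /negPf ne_cb; rewrite /qshift ne_cb.
have -> : x i / qshift (-1) b y b = q * (x i / y b).
  by rewrite /qshift eqxx -invr_expz expr1z; field; rewrite y0 q0.
rewrite -/(qratio q (x i / y b) (e i)) -/(qratio q (q * (x i / y b)) (e i)).
rewrite -[q * x i / _]mulrA -qratioSl // qratioSr //; congr (_ * _).
by rewrite expfzDr // expr1z -exprnP; congr (1 - _); ring.
Qed.

(** For fixed [e], the sum over removed last boxes is a sum of residues at the column ends.
    [sum_residues] moves it to the poles [y b / q], and [vterm_shift_pole] absorbs the dependence on
    [e]. *)
Lemma vsum_last x y (l : int) d : qseparated x -> qseparated y -> qdisjoint x y ->
  1 - #|A|%:Z <= l <= #|B|%:Z ->
  (1 - q ^+ d.+1) * vsum x y l d.+1 =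
  \sum_b (y b / q) ^ l /
         (\prod_j (1 - q * x j / y b) * \prod_(c | c != b) (1 - y b / y c))
         * vsum x (qshift (-1) b y) l d
  + (l == #|B|%:Z)%:R * \prod_b - (y b / q) * vsum x y l d.
Proof.
move=> x_sep y_sep xy l_range.
have x0 := qseparated_neq0 x_sep.
have y0 := qseparated_neq0 y_sep.
have qn0 n : q ^+ n != 0 by rewrite expf_neq0.
pose W i (e : {ffun A -> nat}) :=
  \prod_j (1 - x i * q ^+ e i / x j) /
  \prod_(j | j != i) (1 - (x i * q ^+ e i) / (x j * q ^+ e j)).
rewrite /vsum (@box_removal_sum d W) => [|e|i e ei0]; last 2 first.
- have -> : q ^+ (\sum_j e j) = \prod_j (x j * q ^+ e j / x j).
    by rewrite expr_sum; apply: eq_bigr => j _; rewrite mulrAC divff // mul1r.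
  rewrite -sum_box_weights // => [|j]; first exact: qseparated_box_inj.
  by rewrite mulf_neq0.
- by rewrite /W (bigD1 i) //= ei0 expr0 mulr1 divff // subrr !mul0r.
rewrite exchange_big /=.
under [in RHS]eq_bigr do rewrite mulr_sumr.
rewrite [in RHS]exchange_big mulr_sumr -big_split /=; apply: eq_bigr => e _.
pose u j := x j * q ^+ e j; pose v b := y b / q.
have qu i b : q * u i / y b = u i / v b by rewrite /v; field; rewrite y0 q0.
have vv b c : v b / v c = y b / y c by rewrite /v; field; rewrite y0 q0.
(* The weight [W] cancels the product over the [x j] and the factors [1 - q * u i / u j] of
   [vterm_last]. *)
transitivity (vterm x y l e *
  \sum_i u i ^ l / (\prod_(j | j != i) (1 - u j / u i) * \prod_b (1 - u i / v b))).
  rewrite mulr_sumr; apply: eq_bigr => i _.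
  rewrite vterm_last // mulrCA; congr (_ * _).
  have aE : x i * q ^+ addbox i e i = q * u i.
    by rewrite ffunE eqxx addn1 exprS /u; ring.
  rewrite /W aE -/(u i).
have -> : \prod_(j | j != i) (1 - q * u i / (x j * q ^+ addbox i e j)) =
            \prod_(j | j != i) (1 - q * u i / u j).
    by apply: eq_bigr => j /negPf ne_ji; rewrite ffunE ne_ji addn0.
  under [X in _ = _ / (_ * X)]eq_bigr do rewrite -qu.
  have nz1 : \prod_j (1 - q * u i / x j) != 0.
    apply/prodf_neq0 => j _; rewrite /u mulrCA -exprS.
    have [->|ne_ij] := eqVneq i j.
      by rewrite mulrAC divff // mul1r (qseparated_expn x_sep).
    have := qseparated_regular x_sep ne_ij (e i).+1.
    by rewrite -exprnP mulrA [q ^+ _ * _]mulrC.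
  have nz2 : \prod_(j | j != i) (1 - q * u i / u j) != 0.
    apply/prodf_neq0 => j; rewrite eq_sym => ne_ij.
    have := qseparated_regular x_sep ne_ij ((e i)%:Z - (e j)%:Z + 1).
    rewrite expfzDr // expr1z expz_subnat.
    by congr (1 - _ != 0); rewrite /u; field; rewrite x0 qn0.
  rewrite [X in _ * X / _](_ : _ = \prod_(j | j != i) (1 - q * u i / u j) /
    \prod_(j | j != i) (1 - u j / u i)); last by rewrite big_split /= prodfV.
  rewrite invfM -/(u i).
  move: (\prod_(j | _) (1 - u _ / u _))^-1 (\prod_b (1 - q * _ / y b))^-1 => a b.
  by field; rewrite nz1 nz2.
rewrite sum_residues //; first last.
- by move=> b; rewrite mulf_neq0 ?invr_eq0.
- by move=> j; rewrite mulf_neq0.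
(* A collision of the poles [u i] and [v b] would put [x i] and [y b] in the same [q]-orbit. *)
- move=> i b; apply/eqP => uv; have /eqP[] := xy i b (- (e i)%:Z - 1).
  have -> : q ^ (- (e i)%:Z - 1) = q ^- (e i) / q.
    by rewrite expfzDr // -exprnN -[q ^ (-1)]invr_expz.
  by rewrite -mulrA [_^-1 * y b]mulrC -/(v b) -uv /u mulrC mulfK.
- move=> b c /(mulIf _) bc; have [|] := y_sep b c 0 => //.
  by rewrite expr0z mul1r bc ?invr_eq0.
- exact: qseparated_box_inj.
rewrite mulrDr [in X in _ + X = _]mulrC; congr (_ + _).
rewrite mulr_sumr; apply: eq_bigr => b _.
under [X in _ * (_ / (_ * X)) = _]eq_bigr do rewrite vv.
have := vterm_shift_pole l e b xy y0.
under eq_bigr do rewrite qu.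
rewrite -/(v b) => E.
rewrite (invfM (\prod_j _)) [in RHS](invfM (\prod_j _)).
by rewrite mulrCA -mulrA; congr (_ * _); rewrite mulrA E [RHS]mulrC mulrA.
Qed.

End Terms.

(** * Level duality by induction on the degree *)

Section Duality.
Variables (A B : finType).
Implicit Types (x : A -> F) (y : B -> F).

Lemma eq_vsum (C D : finType) (x x' : C -> F) (y y' : D -> F) l d :
  x =1 x' -> y =1 y' -> vsum x y l d = vsum x' y' l d.
Proof.
move=> eqx eqy; apply: eq_bigr => e _; rewrite /vterm.
congr (_ * _ / _); apply: eq_bigr => i _; rewrite ?eqx //;
by apply: eq_bigr => j _; rewrite ?eqx ?eqy.
Qed.

(* The power of [q] accounts for the exponent [d(d+1)/2] in the level structure
   of the dual I-function, against [d(d-1)/2] in [vterm]. *)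
Definition vsum_dual x y (l : int) d : F :=
  q ^ (- l * d%:Z) * vsum (fun b => (y b)^-1) (fun i => (x i)^-1) (- l) d.

Lemma vsum0 (C D : finType) (x : C -> F) (y : D -> F) l : vsum x y l 0 = 1.
Proof.
have comps0 : compositions C 0 = [:: [ffun=> 0%N]].
  apply: perm_small_eq => //; apply: uniq_perm; rewrite ?compositions_uniq //.
  move=> e; rewrite mem_compositions inE sum_nat_eq0.
  apply/forall_inP/eqP => [e0|-> i _]; last by rewrite ffunE.
  by apply/ffunP => i; rewrite ffunE; apply/eqP/e0.
rewrite /vsum comps0 big_seq1 /vterm.
rewrite big1 ?mul1r => [|i _]; last first.
  by rewrite big1 // => j _; rewrite !ffunE /= big_geq // divr1.
rewrite big1 ?mul1r => [|i _]; last by rewrite !ffunE mulr1 exp1rz.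
by rewrite big1 ?invr1 // => i _; rewrite big1 // => b _; rewrite ffunE /= big_geq.
Qed.

Lemma qseparatedV (C : Type) (z : C -> F) :
  qseparated z -> qseparated (fun i => (z i)^-1).
Proof.
move=> z_sep i j k E; have [|-> k0] := z_sep i j (- k).
  by rewrite -invr_expz -[LHS]invrK E invfM invrK.
by split=> //; apply: oppr_inj; rewrite k0 oppr0.
Qed.

Lemma qdisjointV x y :
  qdisjoint x y -> qdisjoint (fun b => (y b)^-1) (fun i => (x i)^-1).
Proof.
move=> xy b i k; apply/eqP => E; have /eqP[] := xy i b k.
by rewrite -[y b]invrK E invfM invrK mulVKf ?expfz_neq0.
Qed.

Lemma qshift_exprz (C : eqType) (m : int) (b : C) (z : C -> F) c :
  exists k : int, qshift m b z c = q ^ k * z c.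
Proof.
rewrite /qshift; case: eqP => _; [by exists m | by exists 0; rewrite mul1r].
Qed.

(** Genericity only concerns [q]-orbits, so it survives the shifts made by the recursions. *)
Lemma qseparated_shift (C : eqType) (m : int) (b : C) (z : C -> F) :
  qseparated z -> qseparated (qshift m b z).
Proof.
move=> z_sep i j k; have [ki Ei] := qshift_exprz m b z i.
have [kj Ej] := qshift_exprz m b z j.
move=> E; have eq_ij : i = j.
  have [|//] := z_sep i j (- ki + k + kj).
  rewrite !expfzDr // -mulrA -Ej -mulrA -E Ei -invr_expz mulKf // expfz_neq0 //.
split=> //; move: E; rewrite -eq_ij Ei mulrCA => E.
have [|_ //] := z_sep i i k.
by apply: (mulfI (expfz_neq0 ki q0)).
Qed.

Lemma qdisjoint_shift x y (m : int) (b : B) :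
  qdisjoint x y -> qdisjoint x (qshift m b y).
Proof.
move=> xy i c k; have [kc ->] := qshift_exprz m b y c.
by rewrite mulrA -expfzDr.
Qed.

(** This is [vsum_first] for the inverse weights: shifting [1 / y b] by [q] shifts [y b] by [1 / q],
    and the prefactor of [vsum_dual] supplies the [q ^ (- l)] that turns [y b ^ l] into
    [(y b / q) ^ l]. *)
Lemma vsum_dual_rec x y (l : int) d :
  qseparated x -> qseparated y -> qdisjoint x y ->
  (1 - q ^+ d.+1) * vsum_dual x y l d.+1 =
  \sum_b (y b / q) ^ l /
         (\prod_j (1 - q * x j / y b) * \prod_(c | c != b) (1 - y b / y c))
         * vsum_dual x (qshift (-1) b y) l d.
Proof.
move=> x_sep y_sep xy; rewrite /vsum_dual mulrCA vsum_first; first last.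
- by move=> i; rewrite invr_eq0 qseparated_neq0.
- exact: qdisjointV.
- exact: qseparatedV.
rewrite mulr_sumr; apply: eq_bigr => b _.
have -> : vsum (qshift 1 b (fun c => (y c)^-1)) (fun i => (x i)^-1) (- l) d =
          vsum (fun c => (qshift (-1) b y c)^-1) (fun i => (x i)^-1) (- l) d.
  apply: eq_vsum => // c; rewrite /qshift; case: eqP => // _.
  by rewrite -invr_expz invfM invrK.
rewrite mulrCA [RHS]mulrA mulrC -[LHS]mulrA [RHS]mulrC.
rewrite mulrCA; congr (_ * _).
have -> : \prod_(c | c != b) (1 - (y c)^-1 / (y b)^-1) =
          \prod_(c | c != b) (1 - y b / y c).
  by apply: eq_bigr => c _; rewrite invrK mulrC.
have -> : \prod_j (1 - q * (y b)^-1 / (x j)^-1) = \prod_j (1 - q * x j / y b).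
  by apply: eq_bigr => j _; rewrite invrK mulrAC.
rewrite [\prod_(c | _) _ * _]mulrC mulrC [RHS]mulrC !mulrA; congr (_ / _).
rewrite exprz_inv opprK expfzMl exprz_inv intS mulrDr mulr1 expfzDr //; ring.
Qed.

(** For [l < #|B|] the residue at infinity vanishes, so [vsum_last] and [vsum_dual_rec] are the same
    recursion. The element [a0] witnesses that [q] is not a root of unity, so [1 - q ^+ d.+1] can be
    cancelled. *)
Lemma level_duality (a0 : A) x y (l : int) d :
  qseparated x -> qseparated y -> qdisjoint x y ->
  1 - #|A|%:Z <= l < #|B|%:Z -> vsum x y l d = vsum_dual x y l d.
Proof.
(* The recursion shifts [y], so the induction hypothesis must cover all [y]. *)
move=> x_sep + + /andP[l_ge l_lt]; elim: d y => [|d IHd] y y_sep xy.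
  by rewrite /vsum_dual !vsum0 mulr0 expr0z mulr1.
apply: (mulfI (qseparated_expn x_sep a0 (ltn0Sn d))).
rewrite vsum_last ?l_ge ?ltW // vsum_dual_rec // lt_eqF // !mul0r addr0.
apply: eq_bigr => b _; congr (_ * _); apply: IHd.
  exact: qseparated_shift.
exact: qdisjoint_shift.
Qed.

(** This is [C_s(m, d)] at a fixed point, with [Y] the inverse of the determinant class. *)
Definition top_coef (Y : F) (m s d : nat) : F :=
  (-1) ^+ (m * s) * Y ^+ s / (qpoch q q s * q ^+ (s * (d - s + m))).

Lemma top_coef0 Y m d : top_coef Y m 0 d = 1.
Proof. by rewrite /top_coef /qpoch big_ord0 muln0 mul0n !expr0 !mulr1 divr1. Qed.

(* The [q]-Pascal rule matching [vsum_last] at [l = #|B|], where the shift of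
   one [y b] replaces [Y] by [Y / q]. *)
Lemma top_coefS Y m d t : (forall k, (0 < k)%N -> 1 - q ^+ k != 0) ->
  (t <= d)%N ->
  (1 - q ^+ d.+1) * top_coef Y m t.+1 d.+1 =
  (1 - q ^+ (d - t)) * top_coef (Y / q) m t.+1 d +
  (- 1) ^+ m * Y / q ^+ m * top_coef Y m t d.
Proof.
move=> qk le_td; have [n dE] : exists n, d = (n + t)%N.
  by exists (d - t)%N; rewrite subnK.
have qn0 k : q ^+ k != 0 by rewrite expf_neq0.
have P0 : qpoch q q t != 0.
  by apply/prodf_neq0 => k _; rewrite -exprSr qk.
have Ps : qpoch q q t.+1 = qpoch q q t * (1 - q ^+ t.+1).
  by rewrite /qpoch big_ord_recr /= -exprSr.
have a0 : 1 - q ^+ t.+1 != 0 by rewrite qk.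
rewrite /top_coef Ps subSS {}dE addnK -addnS exprD.
have -> : q ^+ (t * (n + m)) = q ^+ (t.+1 * (n + m)) / (q ^+ n * q ^+ m).
  by rewrite mulSn !exprD; field; rewrite !qn0.
rewrite mulnS exprD exprMn exprVn (exprS Y).
(* For [d = t] the subtraction [d - t.+1] is truncated, but the term containing it has coefficient
   [1 - q ^+ 0 = 0]. *)
case: n => [|n].
  rewrite !expr0 subrr mul0r add0r !mul1r add0n.
  move: (qn0 m) (qn0 (t.+1 * m)%N) P0 a0.
  move: (q ^+ m) (q ^+ (t.+1 * m)) (qpoch q q t) (q ^+ t.+1) => b c p a b0 c0 p0 a0.
  move: ((-1) ^+ m) ((-1) ^+ (m * t)) (Y ^+ t) => u v w.
  by field; rewrite b0 c0 p0 a0.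
have -> : q ^+ (t.+1 * (n.+1 + t - t.+1 + m)) = q ^+ (t.+1 * (n.+1 + m)) / q ^+ t.+1.
  rewrite (_ : n.+1 + m = (n + m).+1)%N // mulnS exprD.
  by rewrite (_ : n.+1 + t - t.+1 = n)%N ?mulKf //; [rewrite mulrC mulKf | lia].
move: (qn0 m) (qn0 (t.+1 * (n.+1 + m))%N) (qn0 n.+1) P0 a0 (qn0 t.+1).
move: (q ^+ m) (q ^+ (t.+1 * (n.+1 + m))) (q ^+ n.+1) (qpoch q q t) (q ^+ t.+1).
move: ((-1) ^+ m) ((-1) ^+ (m * t)) (Y ^+ t) => u v w b c e p a b0 c0 e0 p0 a0 a'0.
by field; rewrite b0 c0 e0 p0 a0 a'0.
Qed.

Lemma exchange_scaled (I J : finType) (a : I -> F) (c : J -> F) (D : I -> J -> F) :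
  \sum_i a i * (\sum_j c j * D i j) = \sum_j c j * (\sum_i a i * D i j).
Proof.
under eq_bigr do rewrite mulr_sumr.
rewrite exchange_big; apply: eq_bigr => j _; rewrite mulr_sumr.
by apply: eq_bigr => i _; rewrite mulrCA.
Qed.

(** The induction hypothesis is inserted into both parts of [vsum_last]. The shifted dual sums
    recombine by [vsum_dual_rec], and [top_coefS] matches the coefficients. *)
Lemma level_duality_top (a0 : A) x y d :
  qseparated x -> qseparated y -> qdisjoint x y ->
  vsum x y #|B|%:Z d =
  \sum_(s < d.+1) top_coef (\prod_b y b) #|B| s d * vsum_dual x y #|B|%:Z (d - s).
Proof.
move=> x_sep; have qk k : (0 < k)%N -> 1 - q ^+ k != 0.
  exact: qseparated_expn x_sep a0 k.
have l_range : 1 - #|A|%:Z <= #|B|%:Z <= #|B|%:Z.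
  have : (0 < #|A|)%N by apply/card_gt0P; exists a0.
  lia.
elim: d y => [|d IHd] y y_sep xy.
  by rewrite big_ord1 top_coef0 /vsum_dual !vsum0 mulr0 expr0z !mulr1.
apply: (mulfI (qk _ (ltn0Sn d))); rewrite vsum_last // eqxx mul1r.
set Y := \prod_b y b.
(* The product does not depend on which weight is shifted, so the coefficients leave the sum over
   [b]. *)
have YE b : \prod_c qshift (-1) b y c = Y / q.
  rewrite [RHS]mulrC; apply: (@prod_ratio _ _ _ _ b) => [|c /negPf ne_cb].
    by rewrite /qshift eqxx -invr_expz.
  by rewrite /qshift ne_cb.
have -> : \prod_b - (y b / q) = (- 1) ^+ #|B| * Y / q ^+ #|B|.
  under eq_bigr do rewrite -mulN1r.
  by rewrite big_split prodr_const big_split /= prodr_const exprVn mulrA.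
rewrite (IHd y) //.
under [X in X + _ = _]eq_bigr => b _.
  rewrite (IHd (qshift (-1) b y)); last 2 first.
  - exact: qseparated_shift.
  - exact: qdisjoint_shift.
  rewrite YE.
  over.
rewrite exchange_scaled.
under [X in X + _ = _]eq_bigr => s _.
  rewrite -vsum_dual_rec // mulrA -subSn ?leq_ord //.
  over.
(* The added index [s = d.+1] contributes zero, through the factor [1 - q ^+ 0]. *)
rewrite [X in X + _ = _](_ : _ = \sum_(s < d.+2) top_coef (Y / q) #|B| s d *
    (1 - q ^+ (d.+1 - s)) * vsum_dual x y #|B| (d.+1 - s)); last first.
  by rewrite [RHS]big_ord_recr /= subnn subrr mulr0 mul0r addr0.
rewrite !mulr_sumr big_ord_recl [RHS]big_ord_recl -addrA; congr (_ + _).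
  by rewrite !top_coef0 !mul1r subn0.
rewrite -big_split; apply: eq_bigr => s _ /=; rewrite /bump leq0n !add1n subSS.
rewrite [RHS]mulrA top_coefS ?leq_ord // [RHS]mulrDl; congr (_ + _); last by rewrite mulrA.
by rewrite [top_coef _ _ _ _ * _]mulrC.
Qed.

End Duality.
(* The case [l = #|B|] read on the dual side, where [x] and [y] become
   [1 / y] and [1 / x]. *)
Lemma level_duality_bottom (A B : finType) (b0 : B) (x : A -> F) (y : B -> F) d :
  qseparated x -> qseparated y -> qdisjoint x y ->
  vsum_dual x y (- #|A|%:Z) d =
  \sum_(s < d.+1) q ^+ (#|A| * s) * top_coef (\prod_i (x i)^-1) #|A| s d *
                  vsum x y (- #|A|%:Z) (d - s).
Proof.
move=> x_sep y_sep xy.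
rewrite /vsum_dual opprK (level_duality_top b0) //; first last.
- exact: qdisjointV.
- exact: qseparatedV.
- exact: qseparatedV.
rewrite mulr_sumr; apply: eq_bigr => s _; rewrite /vsum_dual.
rewrite (@eq_vsum _ _ _ x _ y) => [|i|b]; rewrite ?invrK //.
(* The two factors are the prefactors of [vsum_dual] in degree [d] and, for the inverse weights, in
   degree [d - s]. *)
have -> : q ^+ (#|A| * s) = q ^ (#|A|%:Z * d%:Z) * q ^ (- #|A|%:Z * (d - s)%:Z).
  by rewrite -expfzDr // exprnP; congr (_ ^ _); have := leq_ord s; nia.
by move: (top_coef _ _ _ _) (q ^ _) (q ^ _) (vsum _ _ _ _) => a b c e; ring.
Qed.

Lemma top_coefV (W : F) m s d :
  top_coef W^-1 m s d =
  (-1) ^+ (m * s) / (qpoch q q s * q ^+ (s * (d - s + m)) * W ^+ s).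
Proof. by rewrite /top_coef exprVn [in RHS]invfM mulrA mulrAC. Qed.

(** The power [q ^+ (m * s)] accounts for the difference between the exponents of [q] in [C_s] and
    [D_s]. *)
Lemma top_coefV_scaled (W : F) m s d :
  q ^+ (m * s) * top_coef W^-1 m s d =
  (-1) ^+ (m * s) / (qpoch q q s * q ^+ (s * (d - s)) * W ^+ s).
Proof.
rewrite top_coefV mulnDr exprD [(s * m)%N]mulnC !invfM.
have := expf_neq0 (m * s) q0.
move: (q ^+ (m * s)) (qpoch q q s)^-1 (q ^+ (s * (d - s)))^-1 => a b c a0.
by move: ((W ^+ s)^-1) => w; field.
Qed.

End Vortex.

(** * The I-functions at a fixed point as vortex sums *)

Section FixedPoints.
Variables (F : fieldType) (q : F) (n : nat).
Implicit Types Lam : 'I_n -> F.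

Lemma fixpt_nth_inj r (I : fixpt r n) : injective (fixpt_nth I).
Proof. by move=> i j /enum_val_inj /cast_ord_inj. Qed.

Lemma fixpt_nth_compl r (I : fixpt r n) i b : fixpt_nth I i != fixpt_nth (fixpt_compl I) b.
Proof.
apply/eqP => E; have := enum_valP (cast_ord (esym (eqP (valP (fixpt_compl I)))) b).
by rewrite -[enum_val _]/(fixpt_nth (fixpt_compl I) b) -E inE enum_valP.
Qed.

Lemma prod_fixpt_nth r (I : fixpt r n) (G : 'I_n -> F) :
  \prod_m G m = \prod_i G (fixpt_nth I i) * \prod_b G (fixpt_nth (fixpt_compl I) b).
Proof.
have half s (J : fixpt s n) : \prod_(m in val J) G m = \prod_i G (fixpt_nth J i).
  rewrite big_enum_val (reindex (cast_ord (esym (eqP (valP J))))) //=.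
  exact/onW_bij/(Bijective (cast_ordK _) (cast_ordKV _)).
rewrite -!half (bigID (mem (val I))) /=; congr (_ * _).
by apply: eq_bigl => m; rewrite inE.
Qed.

(** The hypothesis on all [G] expresses that the weights [Lam] are those of [x] and [y] together,
    with multiplicity; it splits the denominator as [vterm] requires. *)
Lemma Icoef_vsum Lam r (l : int) d m (x : 'I_r -> F) (y : 'I_m -> F) :
  (forall G : F -> F, \prod_k G (Lam k) = \prod_i G (x i) * \prod_b G (y b)) ->
  Icoef q Lam l d x = vsum q x y l d.
Proof.
move=> LamE; rewrite /vsum /compositions big_map big_filter big_enum_cond /=.
apply: eq_bigr => e _; rewrite /vterm.
rewrite [X in _ = X * _ / _](_ : _ =
    \prod_i \prod_j qratio q (x i / x j) ((e i)%:Z - (e j)%:Z) /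
    \prod_i \prod_j qratio q (x i / x j) (e i)); last first.
  rewrite -prodf_div; apply: eq_bigr => i _; rewrite -prodf_div.
  by apply: eq_bigr => j _; rewrite !ffunE.
rewrite -!mulrA [X in _ = _ * X]mulrCA -invfM; congr (_ * _).
rewrite prodf_div; congr (_ / _).
  by apply: eq_bigr => i _; rewrite !ffunE divn2 bin2.
rewrite -big_split; apply: eq_bigr => i _ /=; rewrite ffunE.
under eq_bigr => k _ do rewrite (LamE (fun z => 1 - q ^+ k * x i * z^-1)).
rewrite big_split /=; congr (_ * _); rewrite exchange_big;
by apply: eq_bigr => j _; apply: eq_bigr => k _; rewrite mulrA.
Qed.

Lemma Icoef_dual_vsum Lam r (l : int) d m (x : 'I_r -> F) (y : 'I_m -> F) :
  (forall G : F -> F, \prod_k G (Lam k) = \prod_i G (x i) * \prod_b G (y b)) ->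
  Icoef_dual q Lam (- l) d (fun b => (y b)^-1) = vsum_dual q x y l d.
Proof.
move=> LamE; rewrite /vsum_dual -(@Icoef_vsum (fun k => (Lam k)^-1)); last first.
  by move=> G; rewrite (LamE (fun z => G z^-1)) mulrC.
rewrite /Icoef mulr_sumr; apply: eq_bigr => e /eqP sum_e.
rewrite mulrCA; congr (_ * _).
(* The prefactor is spread over the columns, where [q ^+ e i] raises the exponent ['C(e i, 2)] to
   ['C((e i).+1, 2)]. *)
have -> : q ^ (- l * d%:Z) = \prod_(i < m) (q ^+ e i) ^ (- l).
  rewrite -[in LHS]sum_e mulrC -exprz_exp -exprnP expr_sum.
  by rewrite (big_morph (fun z => z ^ (- l)) (fun a b => expfzMl a b (- l)) (exp1rz _ _)).
rewrite -big_split; apply: eq_bigr => i _ /=; rewrite mulrA -expfzMl; congr (_ ^ _ / _).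
  rewrite mulrCA -exprD; congr (_ * q ^+ _).
  by rewrite !divn2 [(e i * (e i).+1)%N]mulnC -(bin2 (e i).+1) binS bin1 bin2 addnC.
by apply: eq_bigr => k _; apply: eq_bigr => j _; rewrite invrK.
Qed.

End FixedPoints.

(** * Genericity of the torus characters *)

Section Generic.
Variables (R : realType) (n : nat).

Lemma qvar_neq0 : qvar R n != 0.
Proof. by rewrite tofrac_eq0 mpolyC_eq0 tofrac_eq0 polyX_eq0. Qed.

Lemma qvar_expn k : qvar R n ^+ k = tofrac (mpolyC n (tofrac 'X^k : Cq R)).
Proof. by rewrite /qvar -!rmorphXn. Qed.

(** Comparing coefficients of the monomial ['X_i] forces [i = j]; then ['X^k = 1] among polynomials
    in [q] forces [k = 0]. *)
Lemma Lambda_separated : qseparated (qvar R n) (Lambda R n).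
Proof.
have sep (i j : 'I_n) (k : nat) :
    Lambda R n i = qvar R n ^+ k * Lambda R n j -> i = j /\ k = 0%N.
  rewrite qvar_expn -rmorphM => /eqP; rewrite tofrac_eq => /eqP.
  move/(congr1 (mcoeff U_(i)%MM)); rewrite mcoeffCM !mcoeffXU eqxx.
  case: eqVneq => [-> | _]; last by rewrite mulr0 => /eqP; rewrite oner_eq0.
  rewrite mulr1 => /eqP; rewrite -tofrac1 tofrac_eq => /eqP/(congr1 (size \o val)) /=.
  by rewrite size_polyXn size_poly1 => -[].
(* A negative exponent is excluded by reading the relation backwards, with exponent [k.+1]. *)
move=> i j [k | k] E.
  by have [-> ->] := sep i j k E.
have [|_ //] := sep j i k.+1.
by rewrite E NegzE -exprnN mulVKf // expf_neq0 // qvar_neq0.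
Qed.

Lemma Lambda_sub_separated (C : Type) (f : C -> 'I_n) : injective f ->
  qseparated (qvar R n) (fun i => Lambda R n (f i)).
Proof. by move=> f_inj i j k /Lambda_separated[/f_inj]. Qed.

End Generic.

Lemma KTdual_sum (F : fieldType) (r n : nat) (N : nat) (f : 'I_N -> KTloc F (n - r) n)
    (I : fixpt r n) :
  KTdual (\sum_s f s) I = \sum_s f s (fixpt_compl I).
Proof. by rewrite ffunE sum_ffunE. Qed.

Theorem theorem1p1 (R : realType) (n r : nat) (r_gt0 : (0 < r)%N)
    (r_lt_n : (r < n)%N) (l : int) (d : nat) (d_gt0 : (0 < d)%N) :
  let q := qvar R n in
  let Lam := Lambda R n in
  [/\ 1 - r%:Z <= l <= n%:Z - r%:Z - 1 ->
      IGr q Lam r l d = KTdual (IGr_dual q Lam (n - r) (- l) d),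
      l = n%:Z - r%:Z ->
      IGr q Lam r l d =
      KTdual (\sum_(s < d.+1)
                Ccoef q (detS_dual Lam (n - r)) s (n - r) d *
                IGr_dual q Lam (n - r) (- l) (d - s))
    & l = - r%:Z ->
      KTdual (IGr_dual q Lam (n - r) (- l) d) =
      \sum_(s < d.+1) Dcoef q (detS Lam r) s r d * IGr q Lam r l (d - s)].
Proof.
move=> q Lam; have q0 : q != 0 := qvar_neq0 R n.
have nrE : (n - r)%N%:Z = n%:Z - r%:Z by lia.
pose x (I : fixpt r n) := root_at Lam I.
pose y (I : fixpt r n) := root_at Lam (fixpt_compl I).
have x_sep I : qseparated q (x I) by apply: Lambda_sub_separated; apply: fixpt_nth_inj.
have y_sep I : qseparated q (y I) by apply: Lambda_sub_separated; apply: fixpt_nth_inj.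
have xy I : qdisjoint q (x I) (y I).
  move=> i b k; apply/eqP => /Lambda_separated[E _].
  by have := fixpt_nth_compl I i b; rewrite E eqxx.
have LamE I (G : KTpt R n -> KTpt R n) :
    \prod_k G (Lam k) = \prod_i G (x I i) * \prod_b G (y I b).
  exact: prod_fixpt_nth I (fun k => G (Lam k)).
have IE I k e : IGr q Lam r k e I = vsum q (x I) (y I) k e.
  by rewrite ffunE (Icoef_vsum _ _ _ (LamE I)).
have IdE I k e :
    IGr_dual q Lam (n - r) (- k) e (fixpt_compl I) = vsum_dual q (x I) (y I) k e.
  by rewrite ffunE (Icoef_dual_vsum _ _ _ (LamE I)).
pose i0 := Ordinal r_gt0.
split=> [l_range | lE | lE]; apply/ffunP => I.
- rewrite IE ffunE IdE (level_duality q0 i0) ?card_ord //.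
  by rewrite nrE; lia.
- rewrite IE KTdual_sum lE -nrE.
  have := level_duality_top q0 i0 d (x_sep I) (y_sep I) (xy I).
  rewrite card_ord => ->; apply: eq_bigr => s _.
  rewrite ffunE IdE; congr (_ * _); rewrite !ffunE.
  (* The dual determinant restricts to the product of the inverses of the [y I b], so its inverse is
     the [Y] of [top_coef]. *)
  by rewrite -top_coefV prodfV invrK.
rewrite ffunE lE IdE sum_ffunE.
have b0 : 'I_(n - r) by apply: (@Ordinal _ 0); rewrite subn_gt0.
have := level_duality_bottom q0 b0 d (x_sep I) (y_sep I) (xy I).
rewrite card_ord => ->; apply: eq_bigr => s _.
rewrite [in RHS]ffunE IE; congr (_ * _); rewrite !ffunE.
by rewrite prodfV top_coefV_scaled.
Qed.
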